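(* Let $\Bbbk$ be an $F$-finite field of characteristic $p>0$. Let $g_1,\ldots,g_m\in\Bbbk[x]=\Bbbk[x_1,\ldots,x_n]$ be nonzero polynomials that generate a proper ideal $\mathfrak{a}$, and let $\mathfrak{b}$ be a proper monomial ideal of $\Bbbk[x]$ with $\mathfrak{a}\subseteq\sqrt{\mathfrak{b}}$. Then there exists a closed set $V$ of $\mathbb{A}^m_{\Bbbk}$ with the following property: given an $F$-finite field $\mathbb{L}$ containing $\Bbbk$, and an $m$-tuple $\boldsymbol{\gamma}=(\gamma_1,\ldots,\gamma_m)\in\mathbb{A}^m_{\mathbb{L}}$ for which $g=\gamma_1g_1+\cdots+\gamma_mg_m$ is nonzero, $$\operatorname{c}^{\mathfrak{b}_{\mathbb{L}}}(g)=\operatorname{crit}^{\mathfrak{b}}(\mathfrak{a})\iff\boldsymbol{\gamma}\notin V_{\mathbb{L}}.$$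
   Context: A ring $S$ of characteristic $p$ is $F$-finite if it is a finitely generated module over $S^p$. Below $q$ ranges over powers $p^e$, $e\ge 0$. $\mathfrak{b}_{\mathbb{L}}$ denotes the extension of $\mathfrak{b}$ to $\mathbb{L}[x]$. $\mathbb{A}^m_{\mathbb{L}}=\mathbb{L}^m$, closed sets are zero sets of polynomials, and $V_{\mathbb{L}}$ is the base change of $V$ to $\mathbb{L}$, i.e. the subset of $\mathbb{A}^m_{\mathbb{L}}$ determined by the same equations (with coefficients in $\Bbbk$) that define $V$ in $\mathbb{A}^m_{\Bbbk}$ ($V$ is understood as given with its defining equations). Let $S$ be an $F$-finite regular domain of characteristic $p$, and $\mathfrak{a},\mathfrak{b}$ nonzero proper ideals of $S$ with $\mathfrak{a}\subseteq\sqrt{\mathfrak{b}}$. Put $\mathfrak{a}^{[q]}=\langle f^q:f\in\mathfrak{a}\rangle$, and for $k\in\mathbb{N}$ with base $p$ expansion $k=k_0+k_1p+\cdots+k_rp^r$, $\mathfrak{a}^{[k]}=\mathfrak{a}^{k_0}(\mathfrak{a}^{k_1})^{[p]}\cdots(\mathfrak{a}^{k_r})^{[p^r]}$ (with $\mathfrak{a}^0=S$). The $F$-threshold of $\mathfrak{a}$ with respect to $\mathfrak{b}$ is $\operatorname{c}^{\mathfrak{b}}(\mathfrak{a})=\lim_{q\to\infty}\nu(q)/q=\sup_q\nu(q)/q$ with $\nu(q)=\max\{k\in\mathbb{N}:\mathfrak{a}^k\not\subseteq\mathfrak{b}^{[q]}\}$, and $\operatorname{c}^{\mathfrak{b}}(f)=\operatorname{c}^{\mathfrak{b}}(\langle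 f\rangle)$. The critical (Frobenius) exponent of $\mathfrak{a}$ with respect to $\mathfrak{b}$ is $\operatorname{crit}^{\mathfrak{b}}(\mathfrak{a})=\lim_{q\to\infty}\mu(q)/q=\sup_q\mu(q)/q$ with $\mu(q)=\max\{k\in\mathbb{N}:\mathfrak{a}^{[k]}\not\subseteq\mathfrak{b}^{[q]}\}$. *)

(* Defs.v *)
(* mpoly has to be imported before the MathComp-Analysis files: in the other
   order their notations are incompatible. *)
From HB Require Import structures.
From mathcomp Require Import all_boot all_order all_algebra.
From mathcomp Require Import mpoly.
From mathcomp Require Import boolp classical_sets reals topology normedtype.
From mathcomp Require Import sequences.

Set Implicit Arguments.
Unset Strict Implicit.
Unset Printing Implicit Defensive.

Import GRing.Theory Num.Theory numFieldNormedType.Exports.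

Local Open Scope classical_set_scope.
Local Open Scope ring_scope.

(* Ideals are Prop-valued sets: the ideals of MathComp's ring_quotient are
   proper and carried by boolean predicates. *)
Section Ideals.
Variable S : comNzRingType.
Implicit Types (A I J : set S).

Definition ideal_span A : set S :=
  [set x | exists (r : nat) (c a : 'I_r -> S),
     (forall i, A (a i)) /\ x = \sum_(i < r) c i * a i].

Definition ideal_mul I J : set S :=
  ideal_span [set z | exists x y, [/\ I x, J y & z = x * y]].

Definition ideal_exp I (k : nat) : set S := iter k (ideal_mul I) setT.

Definition ideal_radical I : set S := [set f | exists k : nat, I (f ^+ k)].

Definition frobenius_power I (q : nat) : set S :=
  ideal_span [set f ^+ q | f in I].

(* a^[k] for arbitrary k, from the base p digits k_i = (k %/ p ^ i) %% p.
   All digits with index i > k vanish (for p > 1), and contribute the unit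
   ideal. If k = p ^ e, this agrees with frobenius_power I k when I is an
   ideal and S has characteristic p. *)
Definition digit_power (p : nat) I (k : nat) : set S :=
  \big[ideal_mul/setT]_(i < k.+1)
     frobenius_power (ideal_exp I ((k %/ p ^ i) %% p)) (p ^ i).

End Ideals.

Definition ideal_extension (S T : comNzRingType) (f : S -> T) (I : set S) :
  set T := ideal_span (f @` I).

(* S is a finitely generated module over its subring of p-th powers. *)
Definition F_finite (p : nat) (S : comNzRingType) : Prop :=
  exists (r : nat) (s : 'I_r -> S),
    forall x : S, exists c : 'I_r -> S, x = \sum_(i < r) c i ^+ p * s i.

(* The maximum of P if it exists, and 0 otherwise. *)
Definition max_nat (P : set nat) : nat :=
  xget 0%N [set k | P k /\ forall j, P j -> (j <= k)%N].

Section Thresholds.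
Variables (R : realType) (p : nat) (S : comNzRingType).
Implicit Types a b : set S.

Definition nu a b (q : nat) : nat :=
  max_nat [set k | ~ (ideal_exp a k `<=` frobenius_power b q)].

Definition mu a b (q : nat) : nat :=
  max_nat [set k | ~ (digit_power p a k `<=` frobenius_power b q)].

Definition F_threshold b a : R :=
  limn (fun e : nat => (nu a b (p ^ e))%:R / (p ^ e)%:R : R).

Definition critical_exponent b a : R :=
  limn (fun e : nat => (mu a b (p ^ e))%:R / (p ^ e)%:R : R).

End Thresholds.

Definition monomial_ideal (n : nat) (K : fieldType) (b : set {mpoly K[n]}) :
  Prop :=
  exists M : set 'X_{1..n},
    b = ideal_span [set ('X_[K, u] : {mpoly K[n]}) | u in M].

(* The closed set of L^m cut out by the equations E with coefficients in K.
   For iota = idfun this is the closed set V of K^m defined by E, and in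
   general it is the base change V_L. *)
Definition zero_locus (m : nat) (K L : fieldType) (iota : {rmorphism K -> L})
    (E : set {mpoly K[m]}) : set ('I_m -> L) :=
  [set gamma | forall h, E h -> (map_mpoly iota h).@[gamma] = 0].

(* Main.v *)
Require Import Defs.
From HB Require Import structures.
From mathcomp Require Import all_boot all_order all_algebra.
From mathcomp Require Import zify ring.
From mathcomp Require Import mpoly.
From mathcomp Require Import boolp classical_sets reals topology normedtype.
From mathcomp Require Import sequences.

Import Order.TTheory GRing.Theory Num.Theory numFieldNormedType.Exports.

Local Open Scope classical_set_scope.
Local Open Scope ring_scope.

Set Implicit Arguments.
Unset Strict Implicit.
Unset Printing Implicit Defensive.

(* Both invariants are governed by integer sequences: let mu_e be the largest k
   with a^[k] not in b^[p^e], and nu_e the largest k with g^k not in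
   b_L^[p^e]. Each determines its predecessor, mu_e = floor (mu_(e+1) / p), so
   that the limits are read off from base p digits.

   Let G = z_1 g_1 + ... + z_m g_m with indeterminates z_i. Lucas-type
   uniqueness of base p expansions of exponents shows that a^[k] is generated by
   the z-coefficients of G^k. Hence nu <= mu, and nu_e = mu_e if and only if
   some coefficient of G^(mu_e), at a monomial outside b^[p^e], does not vanish
   at gamma. Since mu_e / p^e is strictly smaller than crit, the limits agree if
   and only if nu = mu.

   It remains to bound e uniformly in L and gamma. Let D be the number of
   monomials of degree at most max deg g_i. Among the D + 1 tails of the digit
   sequence of nu starting at 0, ..., D, two coincide: otherwise the slices
   v |-> (coefficient of g^k at u + q v), for the D + 1 distinct truncated
   tails k < q and suitable u, would be linearly independent polynomials of
   degree at most deg g. Two digit sequences with such coincidences are equal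
   as soon as they agree up to D + D!. So E consists of the coefficients
   of G^(mu_e) for e = D + D!, unless the digits of mu are not of this kind, when
   equality never happens. *)

(** * Digit sequences *)

Lemma max_natP (Q : nat -> Prop) :
    ~ Q 0%N -> (forall k, Q k -> Q k.+1) -> (exists l, Q l) ->
  forall k, Q k <-> (max_nat [set j | ~ Q j] < k)%N.
Proof.
move=> Q0 QS Qex.
have Qle j k : (j <= k)%N -> Q j -> Q k.
  by move=> /subnK <-; elim: (k - j)%N => [|i IHi] // Qj; exact/QS/IHi.
have exb : exists l, `[<Q l>] by case: Qex => l Ql; exists l; apply/asboolP.
case: (ex_minnP exb) => -[|l] /asboolP Ql lmin; first by [].
have nQl : ~ Q l by move=> /asboolP/lmin; rewrite ltnn.
have -> : max_nat [set j | ~ Q j] = l.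
  apply: xget_unique => [|k [nQk kmax]].
    by split=> // j nQj; rewrite leqNgt; apply/negP => /Qle /(_ Ql).
  apply/eqP; rewrite eqn_leq kmax // andbT leqNgt.
  by apply/negP => /Qle /(_ Ql).
by move=> k; split=> [/asboolP/lmin //|/Qle]; apply.
Qed.

(* Equivalently, [N e] is the ceiling of [c * p ^ e] minus one, or the floor of
   [c * p ^ e], for a real number [c]. *)
Definition p_truncations (p : nat) (N : nat -> nat) : Prop :=
  forall e, N e = (N e.+1 %/ p)%N.

Section Truncations.
Variable p : nat.
Hypothesis p_gt1 : (1 < p)%N.
Implicit Types N : nat -> nat.

Let p_gt0 : (0 < p)%N. Proof. exact: ltnW. Qed.

Lemma p_truncationsD N t e :
  p_truncations p N -> N e = (N (e + t)%N %/ p ^ t)%N.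
Proof.
move=> tN; elim: t => [|t ->]; first by rewrite addn0 divn1.
by rewrite tN addnS -divnMA expnS.
Qed.

(** The residue of [N (i + e)] modulo [p ^ e] determines the [e] digits after place [i], so tails
    can be compared through one residue. *)
Lemma p_truncations_digit N i t e : p_truncations p N -> (t < e)%N ->
  (N (i + t.+1)%N %% p)%N =
  (((N (i + e)%N %% p ^ e) %/ p ^ (e - t.+1)) %% p)%N.
Proof.
move=> tN lt_te; rewrite (p_truncationsD (e - t.+1) _ tN) -addnA subnKC //.
set m := (e - t.+1)%N; set x := N _; rewrite {1}(divn_eq x (p ^ e)).
have -> : (x %/ p ^ e * p ^ e = x %/ p ^ e * p ^ t * p * p ^ m)%N.
  by rewrite -!mulnA -expnS -expnD addnS -addSn subnKC.
by rewrite divnMDl ?expn_gt0 ?p_gt0 // modnMDl.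
Qed.

(* [N e %% p] is the [e]-th digit: the digits after the places [i] and [j]
   coincide. *)
Definition digits_recur D N : Prop := exists i j : nat,
  [/\ (i < j)%N, (j <= D)%N
    & forall t, (N (i + t.+1)%N %% p = N (j + t.+1)%N %% p)%N].

(** The period [j - i] is at most [D], hence divides [D!], which is a period independent of the
    sequence. *)
Lemma digits_recur_period D N e : digits_recur D N -> (D < e)%N ->
  (N (e + D`!)%N %% p = N e %% p)%N.
Proof.
move=> [i [j [lt_ij le_jD eqN]]] lt_De.
have lt_ie : (i < e)%N by apply: leq_ltn_trans lt_De; apply: ltnW (leq_trans _ le_jD).
have per c : (N (e + c * (j - i))%N %% p = N e %% p)%N.
  elim: c => [|c IHc]; first by rewrite addn0.
  rewrite -IHc; have := eqN ((e - i).-1 + c * (j - i))%N.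
  have -> : (i + ((e - i).-1 + c * (j - i)).+1 = e + c * (j - i))%N by lia.
  by have -> : (j + ((e - i).-1 + c * (j - i)).+1 = e + c.+1 * (j - i))%N by lia.
have /dvdnP[c ->] : (j - i %| D`!)%N; last exact: per.
by rewrite dvdn_fact // subn_gt0 lt_ij (leq_trans (leq_subr _ _)).
Qed.

Lemma p_truncations_eq D N N' : p_truncations p N -> p_truncations p N' ->
    digits_recur D N -> digits_recur D N' ->
    N (D + D`!)%N = N' (D + D`!)%N ->
  N =1 N'.
Proof.
move=> tN tN' rN rN'; set E := (D + _)%N => eqE.
have eq_le e : (e <= E)%N -> N e = N' e.
  move=> /subnKC eE.
  by rewrite (p_truncationsD (E - e) _ tN) (p_truncationsD (E - e) _ tN') eE eqE.
have eq_digit e : (N e %% p = N' e %% p)%N.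
  (* Beyond [E], both digits repeat those found [D!] places earlier, which still lie after place
     [D]. *)
  elim/ltn_ind: e => e IHe; have [/eq_le -> //|lt_Ee] := leqP e E.
  have lt_De : (D < e - D`!)%N by rewrite ltn_subRL addnC.
  have le_De : (D`! <= e)%N by apply: leq_trans (ltnW lt_Ee); rewrite leq_addl.
  rewrite -(subnK le_De) !digits_recur_period //; apply: IHe.
  by rewrite ltn_subrL fact_gt0 (leq_ltn_trans _ lt_Ee).
elim=> [|e IHe]; first by apply: eq_le.
by rewrite (divn_eq (N e.+1) p) (divn_eq (N' e.+1) p) -tN -tN' IHe eq_digit.
Qed.

(** * Limits of normalized truncations *)

Variable R : realType.
Let u N := fun e => (N e)%:R / (p ^ e)%:R : R.

Let pe_gt0 e : 0 < (p ^ e)%:R :> R.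
Proof. by rewrite ltr0n expn_gt0 p_gt0. Qed.

Lemma p_truncations_nondecreasing N : p_truncations p N -> nondecreasing_seq (u N).
Proof.
move=> tN; apply/nondecreasing_seqP => e; rewrite /u.
rewrite ler_pdivrMr // mulrAC ler_pdivlMr // -!natrM ler_nat expnSr mulnA.
rewrite mulnAC leq_mul2r; apply/orP; right.
by rewrite [N e]tN leq_divM.
Qed.

Lemma p_truncations_le N e t : p_truncations p N ->
  u N (e + t)%N <= (N e).+1%:R / (p ^ e)%:R.
Proof.
move=> tN; rewrite /u ler_pdivrMr // mulrAC ler_pdivlMr // -!natrM ler_nat.
rewrite expnD [in X in (_ <= X)%N]mulnC -mulnA mulnC leq_mul2l; apply/orP; right.
by rewrite (p_truncationsD t e tN) mulnC ltnW // ltn_ceil // expn_gt0 p_gt0.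
Qed.

Lemma p_truncations_cvg N : p_truncations p N -> cvgn (u N).
Proof.
move=> tN; apply: nondecreasing_is_cvgn; first exact: p_truncations_nondecreasing.
by exists ((N 0%N).+1%:R / (p ^ 0)%:R) => _ [e _ <-]; apply: (p_truncations_le 0).
Qed.

Lemma p_truncations_lim_le N e : p_truncations p N ->
  limn (u N) <= (N e).+1%:R / (p ^ e)%:R.
Proof.
move=> tN; apply: limr_le; first exact: p_truncations_cvg.
near=> t; have /subnKC <- : (e <= t)%N by near: t; exact: nbhs_infty_ge.
exact: p_truncations_le.
Unshelve. all: by end_near. Qed.

(** If [N e < N' e], then lim [u N] is at most [(N e + 1) / p ^ e], hence at most [u N' e]. The last
    hypothesis puts [u N' e] strictly below lim [u N']; it excludes two expansions of the same
    number. *)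
Lemma p_truncations_lim_eq N N' : p_truncations p N -> p_truncations p N' ->
    (forall e, (N e <= N' e)%N) ->
    (forall e, exists t, (p ^ t * N' e < N' (e + t))%N) ->
  limn (u N) = limn (u N') <-> N =1 N'.
Proof.
move=> tN tN' leN strictN'; split=> [eq_lim e|eqN]; last first.
  by congr (limn _); apply/funext => e; rewrite /u eqN.
apply/eqP; rewrite eqn_leq leN /= leqNgt; apply/negP => ltN.
have [t lt_t] := strictN' e.
suff : limn (u N) < limn (u N') by rewrite eq_lim ltxx.
apply: le_lt_trans (p_truncations_lim_le e tN) _.
have := nondecreasing_cvgn_le (p_truncations_nondecreasing tN')
          (p_truncations_cvg tN') (e + t)%N.
apply: lt_le_trans.
rewrite /u ltr_pdivrMr // mulrAC ltr_pdivlMr // -!natrM ltr_nat.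
rewrite expnD [X in (X < _)%N]mulnC -mulnA mulnC.
rewrite mulnC [X in (_ < X)%N]mulnC ltn_pmul2l ?expn_gt0 ?p_gt0 //.
by apply: leq_ltn_trans lt_t; rewrite leq_mul2l ltN orbT.
Qed.

End Truncations.

(** * Frobenius powers and coefficients *)

Section FrobeniusCoefficients.
Variables (A : comNzRingType) (p n : nat).
Hypothesis charA : p \in [pchar A].
Implicit Types F h : {mpoly A[n]}.

Lemma pchar_mpoly : p \in [pchar {mpoly A[n]}].
Proof.
rewrite inE (pcharf_prime charA) /= -mpolyC_nat mpolyC_eq0.
by rewrite (pcharf0 charA).
Qed.

Lemma sum_exp_pchar (S : comNzRingType) (I : Type) (r : seq I) (f : I -> S) e :
  p \in [pchar S] -> (\sum_(i <- r) f i) ^+ (p ^ e) = \sum_(i <- r) f i ^+ (p ^ e).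
Proof.
move=> charS; apply: (big_morph (fun x => x ^+ (p ^ e))) => [x y|].
  apply: exprDn_pchar; rewrite pnatX (eq_pnat _ (pcharf_eq charS)).
  by rewrite pnat_id ?(pcharf_prime charS).
by rewrite expr0n expn_eq0 -leqn0 leqNgt prime_gt0 ?(pcharf_prime charS).
Qed.

Lemma mcoeffXM h m w :
  ('X_[m] * h)@_w = if (m <= w)%MM then h@_(w - m)%MM else 0.
Proof.
rewrite mulrC; case: ifP => [/submK {1}<-|nle_mw].
  by rewrite addmC mcoeffMX.
apply: memN_msupp_eq0; rewrite (perm_mem (msuppMX _ _)).
by apply/negP => /mapP[m' _ wE]; rewrite wE lem_addr in nle_mw.
Qed.

Lemma mcoeff_exp_mul F h e (u v : 'X_{1..n}) : (forall i, u i < p ^ e)%N ->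
  (F ^+ (p ^ e) * h)@_(u + v *+ p ^ e)%MM =
  \sum_(w <- msupp F | (w <= v)%MM)
     F@_w ^+ (p ^ e) * h@_(u + (v - w) *+ p ^ e)%MM.
Proof.
move=> lt_u; rewrite {1}[F]mpolyE sum_exp_pchar ?pchar_mpoly //.
rewrite mulr_suml raddf_sum /= [RHS]big_mkcond; apply: eq_bigr => w _.
rewrite exprZn mpolyXn -scalerAl mcoeffZ mcoeffXM.
have -> : (w *+ p ^ e <= u + v *+ p ^ e)%MM = (w <= v)%MM.
  apply/mnm_lepP/mnm_lepP => le_wv i; have := le_wv i;
    rewrite mnmDE !mulmnE.
    have q_gt0 := leq_ltn_trans (leq0n _) (lt_u i).
    by rewrite -leq_divRL // addnC divnMDl // divn_small ?addn0.
  by move=> le; rewrite (leq_trans (leq_mul le (leqnn _))) // leq_addl.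
case: ifP => [/mnm_lepP le_wv|]; last by rewrite mulr0.
congr (_ * _@__); apply/mnmP => i.
by rewrite mnmBE !mnmDE !mulmnE mnmBE mulnBl addnBA // leq_mul2r le_wv orbT.
Qed.

(** Lucas-type uniqueness: when [h] has degree below [p ^ e], only the term [w = v] of the preceding
    sum survives. *)
Lemma mcoeff_exp_mul_small F h e (u v : 'X_{1..n}) : (mdeg u < p ^ e)%N ->
    (forall w, (p ^ e <= mdeg w)%N -> h@_w = 0) ->
  (F ^+ (p ^ e) * h)@_(u + v *+ p ^ e)%MM = F@_v ^+ (p ^ e) * h@_u.
Proof.
move=> lt_u h0; rewrite mcoeff_exp_mul; last first.
  move=> i; apply: leq_ltn_trans lt_u.
  by rewrite mdegE (bigD1 i) //= leq_addr.
have p_gt0 : (0 < p)%N := prime_gt0 (pcharf_prime charA).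
have hE w : (w <= v)%MM -> w != v -> h@_(u + (v - w) *+ p ^ e)%MM = 0.
  move=> le_wv neq_wv; apply: h0; rewrite mdegD mdegMn.
  apply: leq_trans (leq_addl _ _); rewrite leq_pmull // lt0n mdeg_eq0.
  by apply: contra neq_wv => /eqP vw0; rewrite -(submK le_wv) vw0 add0m.
have [vF|vF] := boolP (v \in msupp F); last first.
  rewrite (memN_msupp_eq0 vF) expr0n expn_eq0 -leqn0 leqNgt p_gt0 mul0r.
  rewrite big_seq_cond big1 // => w /andP[wF le_wv].
  by rewrite hE ?mulr0 //; apply: contraNneq vF => <-.
rewrite big_mkcond (bigD1_seq v) ?msupp_uniq //= lepm_refl big1 => [|w neq].
  rewrite addr0; congr (_ * _@__); apply/mnmP => i.
  by rewrite mnmDE mulmnE mnmBE subnn addn0.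
by case: ifP => // le_wv; rewrite hE ?mulr0.
Qed.

Lemma mcoeff_exp F e w : ~ (exists v, w = v *+ p ^ e)%MM -> (F ^+ (p ^ e))@_w = 0.
Proof.
move=> nw; rewrite {1}[F]mpolyE sum_exp_pchar ?pchar_mpoly // raddf_sum /=.
rewrite big1 // => v _; rewrite exprZn mpolyXn mcoeffZ mcoeffX.
by case: eqP => [wE|]; rewrite ?mulr0 //; case: nw; exists v.
Qed.

Lemma mcoeff_expMn F e v : (F ^+ (p ^ e))@_(v *+ p ^ e)%MM = F@_v ^+ (p ^ e).
Proof.
have p_gt0 : (0 < p)%N := prime_gt0 (pcharf_prime charA).
have := @mcoeff_exp_mul_small F 1 e 0%MM v; rewrite mulr1 add0m => ->.
- by rewrite mcoeff1 eqxx mulr1.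
- by rewrite mdeg0 expn_gt0 p_gt0.
by move=> w; rewrite mcoeff1; case: eqP => // ->; rewrite mdeg0 leqNgt expn_gt0 p_gt0.
Qed.

End FrobeniusCoefficients.

Lemma mcoeff_expr_deg (A : nzRingType) n (f : {mpoly A[n]}) d k w :
    (forall v, (d < mdeg v)%N -> f@_v = 0) ->
  (d * k < mdeg w)%N -> (f ^+ k)@_w = 0.
Proof.
move=> f_deg; elim: k w => [|k IHk] w; rewrite ?muln0 => lt_w.
  by rewrite expr0 mcoeff1; case: eqP lt_w => // ->; rewrite mdeg0.
rewrite exprS mcoeffM big1 // => -[k1 k2] /= /eqP wE.
have [le_k1|/f_deg ->] := leqP (mdeg k1) d; last by rewrite mul0r.
rewrite IHk ?mulr0 //; have degE := congr1 mdeg wE; rewrite mdegD in degE.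
rewrite degE mulnS in lt_w.
by rewrite -(ltn_add2l d) (leq_trans lt_w) // leq_add2r.
Qed.

(** * Frobenius powers of monomial ideals through exponents *)

Definition mdivn n (w : 'X_{1..n}) (q : nat) : 'X_{1..n} :=
  [multinom (w i %/ q)%N | i < n].

Lemma mdivnE n (w : 'X_{1..n}) q i : mdivn w q i = (w i %/ q)%N.
Proof. by rewrite mnmE. Qed.

Lemma mdivnMA n (w : 'X_{1..n}) q r : mdivn w (q * r) = mdivn (mdivn w q) r.
Proof. by apply/mnmP => i; rewrite !mdivnE divnMA. Qed.

Lemma mdivn1 n (w : 'X_{1..n}) : mdivn w 1 = w.
Proof. by apply/mnmP => i; rewrite mdivnE divn1. Qed.

Lemma mdivnDMn n (u v : 'X_{1..n}) q : (forall i, u i < q)%N ->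
  mdivn (u + v *+ q)%MM q = v.
Proof.
move=> lt_u; apply/mnmP => i; rewrite mdivnE mnmDE mulmnE addnC.
by rewrite divnMDl ?(leq_ltn_trans _ (lt_u i)) // divn_small ?addn0.
Qed.

Definition upward_closed n (B : set 'X_{1..n}) :=
  forall u v, B u -> B (u + v)%MM.

(* When [B] is the set of exponents of the monomials of a monomial ideal [b],
   this is membership in [frobenius_power b q]. *)
Definition in_frobenius (A : nzRingType) n (B : set 'X_{1..n}) (q : nat) :
    set {mpoly A[n]} :=
  [set h | forall w, ~ B (mdivn w q) -> h@_w = 0].
Arguments in_frobenius {A n} B q.

Section InFrobenius.
Variables (A : comNzRingType) (n : nat) (B : set 'X_{1..n}).
Hypothesis Bup : upward_closed B.
Implicit Types h : {mpoly A[n]}.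

Lemma in_frobenius0 q : in_frobenius B q (0 : {mpoly A[n]}).
Proof. by move=> w _; rewrite mcoeff0. Qed.

Lemma in_frobeniusD q h1 h2 :
  in_frobenius B q h1 -> in_frobenius B q h2 -> in_frobenius B q (h1 + h2).
Proof. by move=> b1 b2 w Bw; rewrite mcoeffD b1 ?b2 ?addr0. Qed.

Lemma in_frobenius_sum (I : Type) (r : seq I) (P : pred I) (f : I -> {mpoly A[n]}) q :
  (forall i, P i -> in_frobenius B q (f i)) ->
  in_frobenius B q (\sum_(i <- r | P i) f i).
Proof. by move=> bf w Bw; rewrite raddf_sum /= big1 // => i /bf ->. Qed.

Lemma in_frobeniusM q h1 h2 : in_frobenius B q h2 -> in_frobenius B q (h1 * h2).
Proof.
move=> b2 w Bw; rewrite mcoeffM big1 // => -[k1 k2] /= /eqP wE.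
rewrite b2 ?mulr0 // => Bk2; apply: Bw; rewrite wE.
have -> : mdivn (k1 + k2)%MM q =
    (mdivn k2 q + (mdivn (k1 + k2) q - mdivn k2 q))%MM.
  apply/mnmP => i; rewrite mnmDE mnmBE !mdivnE mnmDE subnKC //.
  by rewrite leq_div2r // leq_addl.
exact: Bup.
Qed.

Lemma in_frobenius1 q : ~ B 0%MM -> ~ in_frobenius B q (1 : {mpoly A[n]}).
Proof.
move=> B0 /(_ 0%MM); rewrite mcoeff1 eqxx.
have -> : mdivn (0%MM : 'X_{1..n}) q = 0%MM.
  by apply/mnmP => i; rewrite mdivnE mnm0E div0n.
by move=> /(_ B0)/eqP; rewrite oner_eq0.
Qed.

End InFrobenius.

Section InFrobeniusField.
Variables (L : fieldType) (p n : nat) (B : set 'X_{1..n}).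
Hypothesis charL : p \in [pchar L].
Implicit Types h : {mpoly L[n]}.

(** The coefficients of [h ^+ (p ^ e)] are the [p ^ e]-th powers of those of [h], at exponents
    multiplied by [p ^ e], and a field has no nilpotents. *)
Lemma in_frobenius_exp h e t :
  in_frobenius B (p ^ (t + e)) (h ^+ (p ^ e)) <-> in_frobenius B (p ^ t) h.
Proof.
have p_gt0 : (0 < p)%N := prime_gt0 (pcharf_prime charL).
have q_gt0 : (0 < p ^ e)%N by rewrite expn_gt0 p_gt0.
have divE v : mdivn (v *+ p ^ e : 'X_{1..n})%MM (p ^ (t + e)) = mdivn v (p ^ t).
  rewrite expnD mulnC mdivnMA -[X in mdivn X (p ^ e)]add0m mdivnDMn // => i.
  by rewrite mnm0E.
split=> [bh w Bw|bh w Bw].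
  apply/eqP; have := bh (w *+ p ^ e)%MM.
  by rewrite divE mcoeff_expMn // => /(_ Bw)/eqP; rewrite expf_eq0 => /andP[].
have [[v wE]|nw] := pselect (exists v, w = v *+ p ^ e)%MM; last exact: mcoeff_exp.
rewrite wE mcoeff_expMn // bh ?expr0n ?gtn_eqF //.
by rewrite -divE -wE.
Qed.

(** Once [p ^ t] exceeds the degree of [f], the leading exponent of [f] is a mere remainder modulo
    [p ^ t]: it leaves the quotient that decides membership unchanged. *)
Lemma in_frobenius_exp_mul f h e : f != 0 -> ~ in_frobenius B (p ^ e) h ->
  exists2 t, (0 < t)%N & ~ in_frobenius B (p ^ (e + t)) (h ^+ (p ^ t) * f).
Proof.
move=> f_neq0 nh.
have [w [Bw hw]] : exists w, ~ B (mdivn w (p ^ e)) /\ h@_w != 0.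
  apply: contrapT => nex; apply: nh => w Bw; apply/eqP/negPn/negP => hw.
  by apply: nex; exists w.
have p_gt1 : (1 < p)%N := prime_gt1 (pcharf_prime charL).
(* This choice works because [t < p ^ t]. *)
pose t := msize f; exists t; first by rewrite lt0n msize_poly_eq0.
move=> /(_ (mlead f + w *+ p ^ t)%MM).
have lt_size : (msize f < p ^ t)%N by exact: ltn_expl.
have lt_f : (mdeg (mlead f) < p ^ t)%N.
  by apply: leq_ltn_trans lt_size; rewrite -mlead_deg.
rewrite mcoeff_exp_mul_small // => [|v le_v]; last first.
  apply: memN_msupp_eq0; apply: msize_mdeg_ge.
  exact: leq_trans (ltnW lt_size) le_v.
rewrite addnC expnD mdivnMA mdivnDMn; last first.
  move=> i; apply: leq_ltn_trans lt_f.
  by rewrite mdegE (bigD1 i) //= leq_addr.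
move=> /(_ Bw)/eqP; rewrite mulf_eq0 expf_eq0 (negPf hw) andbF /=.
by rewrite mleadc_eq0 (negPf f_neq0).
Qed.

End InFrobeniusField.

(** * Rationality of thresholds of polynomials *)

Definition level (P : nat -> nat -> Prop) (e : nat) : nat :=
  max_nat [set k | ~ P k e].

(* [P k e] stands for the containment of a [k]-th power, or of [a^[k]], in
   [b^[p^e]]. *)
Definition level_family (p : nat) (P : nat -> nat -> Prop) : Prop :=
  [/\ forall e, ~ P 0%N e, forall k e, P k e -> P k.+1 e,
      forall k e, P (k * p)%N e.+1 <-> P k e & exists l, P l 0%N].

Section Levels.
Variables (p : nat) (P : nat -> nat -> Prop).
Hypothesis p_gt0 : (0 < p)%N.
Hypothesis famP : level_family p P.

Lemma levelP k e : P k e <-> (level P e < k)%N.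
Proof.
have [P0 PS Pp [l Pl]] := famP; apply: (max_natP (Q := fun j => P j e)) => //.
  by move=> j; apply: PS.
(* A bound [l] at stage 0 propagates to [l * p ^ e] at stage [e]. *)
exists (l * p ^ e)%N; elim: e => [|e IHe]; first by rewrite muln1.
by rewrite expnSr mulnA; apply/Pp.
Qed.

Lemma level_truncations : p_truncations p (level P).
Proof.
have [_ _ Pp _] := famP.
have iff_lt e k : (level P e < k)%N <-> (level P e.+1 %/ p < k)%N.
  by rewrite ltn_divLR //; split=> /levelP/Pp/levelP.
move=> e; apply/eqP; rewrite eqn_leq; apply/andP.
by split; rewrite -ltnS; apply/iff_lt; rewrite ltnS.
Qed.

End Levels.

Section PowersLevel.
Variables (L : fieldType) (p n : nat) (B : set 'X_{1..n}).
Hypothesis charL : p \in [pchar L].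
Hypothesis Bup : upward_closed B.
Hypothesis B0 : ~ B 0%MM.
Variables (f : {mpoly L[n]}) (d : nat).
Hypothesis f_radical : exists l, in_frobenius B 1 (f ^+ l).
Hypothesis f_deg : forall w, (d < mdeg w)%N -> f@_w = 0.

Let p_gt0 : (0 < p)%N. Proof. exact: prime_gt0 (pcharf_prime charL). Qed.

Definition powers_family k e := in_frobenius B (p ^ e) (f ^+ k).

Lemma powers_level_family : level_family p powers_family.
Proof.
split=> [e|k e|k e|].
- by rewrite /powers_family expr0; apply: in_frobenius1.
- by rewrite /powers_family exprS; apply: in_frobeniusM.
- by rewrite /powers_family exprM -{2}(expn1 p) -addn1; apply: in_frobenius_exp.
exact: f_radical.
Qed.

(** Pigeonhole by linear algebra: [D + 1] distinct tails would give [D + 1] slices in a space of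
    dimension [D], and a linear relation among them contradicts the maximality of the levels. *)
Lemma powers_level_digits_recur :
  digits_recur p #|{: 'X_{1..n < d.+1}}| (level powers_family).
Proof.
set D := #|_|; set N := level powers_family.
have NP k e : powers_family k e <-> (N e < k)%N.
  exact: levelP powers_level_family k e.
have tN : p_truncations p N := level_truncations p_gt0 powers_level_family.
apply: contrapT => nrec.
(* If no two tails coincide, [t] picks a place where each pair differs; [e] below is large enough to
   see all these places, so the residues [val i] are distinct. *)
have /choice[t tP] (ij : 'I_D.+1 * 'I_D.+1) : exists t, (ij.1 < ij.2)%N ->
    (N (ij.1 + t.+1) %% p != N (ij.2 + t.+1) %% p)%N.
  have [lt_ij|le_ji] := boolP (ij.1 < ij.2)%N; last by exists 0%N.
  apply: contrapT => nex; apply: nrec; exists ij.1, ij.2; split=> //.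
    by rewrite -ltnS.
  by move=> t; apply/eqP/negPn/negP => neq; apply: nex; exists t.
pose e := \max_ij (t ij).+1; pose q := (p ^ e)%N.
have q_gt0 : (0 < q)%N by rewrite expn_gt0 p_gt0.
pose val (i : 'I_D.+1) := (N (i + e)%N %% q)%N.
have val_lt i : (val i < q)%N by rewrite ltn_mod.
have val_inj i j : val i = val j -> i = j.
  wlog lt_ij : i j / (i < j)%N => [IH eq_val|eq_val].
    case: (ltngtP i j) => [/IH|/IH|/ord_inj //]; first exact.
    by move=> /(_ (esym eq_val)).
  have := tP (i, j) lt_ij; rewrite /= => /negP[]; apply/eqP.
  have lt_te : (t (i, j) < e)%N by apply: (leq_bigmax (i, j)).
  by rewrite !(p_truncations_digit (prime_gt1 (pcharf_prime charL)) _ tN lt_te)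
             -/(val i) -/(val j) eq_val.
have /choice[w wP] (i : 'I_D.+1) : exists w,
    ~ B (mdivn w (p ^ (i + e))) /\ (f ^+ N (i + e)%N)@_w != 0.
  apply: contrapT => nex; have /NP : ~ (N (i + e) < N (i + e))%N by rewrite ltnn.
  by apply=> w Bw; apply/eqP/negPn/negP => fw; apply: nex; exists w.
pose v i := mdivn (w i) q; pose u i := [multinom (w i j %% q)%N | j < n].
have u_lt i j : (u i j < q)%N by rewrite mnmE ltn_mod.
have wE i : w i = (u i + v i *+ q)%MM.
  by apply/mnmP => j; rewrite mnmDE mulmnE mnmE mdivnE addnC -divn_eq.
pose M := \matrix_(i < D.+1, j < D) (f ^+ val i)@_(u i + enum_val j *+ q)%MM.
(* Row [i] of [M] is a slice of [f ^+ val i]; there are more rows than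
   columns. *)
have : kermx M != 0.
  rewrite kermx_eq0; apply/negP => /eqP rkM.
  by have := rank_leq_col M; rewrite rkM ltnn.
move=> /rowV0Pn[c /sub_kermxP cM0 c_neq0].
(* The columns of [M] cover [mdeg x <= d]. For larger [x] each term vanishes by degree, because
   [val j < q]. *)
have rel0 x : \sum_j c 0 j * (f ^+ val j)@_(u j + x *+ q)%MM = 0.
  have [le_x|lt_x] := leqP (mdeg x) d.
    have /matrixP/(_ 0 (enum_rank (@BMultinom n d.+1 x le_x))) := cM0.
    by rewrite !mxE => cM; rewrite -[RHS]cM; apply: eq_bigr => j _; rewrite mxE enum_rankK.
  rewrite big1 // => j _; rewrite (mcoeff_expr_deg f_deg) ?mulr0 //.
  rewrite mdegD mdegMn; apply: leq_trans (leq_addl _ _).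
  apply: leq_ltn_trans (leq_mul (leqnn d) (ltnW (val_lt j))) _.
  by rewrite ltn_mul2r q_gt0.
have [i1 ci1] : exists i, c 0 i != 0.
  by apply/existsP; apply: contraNT c_neq0; rewrite negb_exists => /forallP c0;
     apply/eqP/matrixP => i j; rewrite ord1 mxE; apply/eqP/negPn.
(* Multiplying the relation [rel0] by the Frobenius twist of [f ^+ N i] kills the
   terms with [val j > val i], as [N (i + e)] is maximal, but not the term
   [j = i]. *)
case: (@arg_minnP _ i1 (fun i => c 0 i != 0) val ci1) => i ci val_min.
suff : c 0 i * (f ^+ N (i + e)%N)@_(w i) = 0.
  by move/eqP; rewrite mulf_eq0 (negPf ci) (negPf (wP i).2).
have powE j : (f ^+ N i) ^+ q * f ^+ val j = f ^+ (N i * q + val j).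
  by rewrite exprD exprM.
have NE : (N i * q + val i)%N = N (i + e)%N.
  by rewrite (p_truncationsD e i tN) -divn_eq.
transitivity (\sum_j c 0 j * ((f ^+ N i) ^+ q * f ^+ val j)@_(u j + v i *+ q)%MM).
  rewrite (bigD1 i) //= powE NE -wE big1 ?addr0 // => j neq_ji.
  have [->|cj] := eqVneq (c 0 j) 0; first by rewrite mul0r.
  have lt_val : (val i < val j)%N.
    by rewrite ltn_neqAle val_min // andbT; apply: contra neq_ji => /eqP/val_inj ->.
  have /NP bj : (N (i + e) < N i * q + val j)%N by rewrite -NE ltn_add2l.
  rewrite powE bj ?mulr0 //.
  (* Replacing the remainder [u i] of [w i] by [u j] does not change the quotient by [p ^ (i + e)],
     which is outside [B]. *)
  rewrite addnC expnD mdivnMA mdivnDMn //.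
  by have := (wP i).1; rewrite addnC expnD mdivnMA.
(* The coefficients of [f ^+ N i] factor out independently of [j]; what remains is [rel0] at
   [v i - x]. *)
under eq_bigr => j _.
  rewrite (mcoeff_exp_mul charL _ _ _ (u_lt j)) mulr_sumr.
  over.
rewrite exchange_big big1 //= => x _.
under eq_bigr => j _ do rewrite mulrCA.
by rewrite -mulr_sumr rel0 mulr0.
Qed.

End PowersLevel.

(** * Ideals *)

Section IdealTheory.
Variable S : comNzRingType.
Implicit Types (A I J : set S).

Definition is_ideal I : Prop :=
  [/\ I 0, forall x y, I x -> I y -> I (x + y) & forall c x, I x -> I (c * x)].

Lemma is_ideal_setT : is_ideal setT. Proof. by []. Qed.

Lemma is_ideal_sum I (T : Type) (r : seq T) (P : pred T) (f : T -> S) :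
  is_ideal I -> (forall i, P i -> I (f i)) -> I (\sum_(i <- r | P i) f i).
Proof. by move=> [I0 ID _] If; apply: big_ind. Qed.

Lemma is_ideal_span A : is_ideal (ideal_span A).
Proof.
split=> [|x y [r [c [u [Au ->]]]] [s [d [v [Av ->]]]]|k x [r [c [u [Au ->]]]]].
- by exists 0%N, (fun=> 0), (fun=> 0); split=> [[]//|]; rewrite big_ord0.
- exists (r + s)%N,
    (fun i => match split i with inl j => c j | inr j => d j end),
    (fun i => match split i with inl j => u j | inr j => v j end).
  split=> [i|]; first by case: split => j; [exact: Au|exact: Av].
  rewrite big_split_ord /=; congr (_ + _); apply: eq_bigr => i _.
    by rewrite (unsplitK (inl _ i)).
  by rewrite (unsplitK (inr _ i)).
exists r, (fun i => k * c i), u; split=> //.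
by rewrite mulr_sumr; apply: eq_bigr => i _; rewrite mulrA.
Qed.

Lemma sub_ideal_span A : A `<=` ideal_span A.
Proof.
move=> x Ax; exists 1%N, (fun=> 1), (fun=> x); split=> //.
by rewrite big_ord1 mul1r.
Qed.

Lemma ideal_span_sub A I : is_ideal I -> A `<=` I -> ideal_span A `<=` I.
Proof.
move=> idI AI _ [r [c [u [Au ->]]]]; apply: is_ideal_sum => // i _.
by have [_ _ IM] := idI; apply/IM/AI.
Qed.

(** The colon ideal [I : x] allows a containment of a product of ideals to be tested on generators,
    one factor at a time. *)
Lemma is_ideal_colon I x : is_ideal I -> is_ideal [set y | I (x * y)].
Proof.
move=> [I0 ID IM]; split=> [|y z /= Iy Iz|c y /= Iy]; first by rewrite /= mulr0.
  by rewrite mulrDr; apply: ID.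
by rewrite mulrCA; apply: IM.
Qed.

Lemma is_ideal_mul I J : is_ideal (ideal_mul I J).
Proof. exact: is_ideal_span. Qed.

Lemma ideal_mulP I J x y : I x -> J y -> ideal_mul I J (x * y).
Proof. by move=> Ix Jy; apply: sub_ideal_span; exists x, y. Qed.

Lemma ideal_mul_sub I J K : is_ideal K ->
  (forall x y, I x -> J y -> K (x * y)) -> ideal_mul I J `<=` K.
Proof.
by move=> idK IJK; apply: ideal_span_sub => // _ [x [y [Ix Jy ->]]]; apply: IJK.
Qed.

Lemma is_ideal_exp I k : is_ideal (ideal_exp I k).
Proof. by case: k => [|k]; [exact: is_ideal_setT|exact: is_ideal_mul]. Qed.

Lemma is_ideal1 I : is_ideal I -> I 1 -> I = setT.
Proof.
move=> [_ _ IM] I1; apply/seteqP; split=> // x _.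
by rewrite -(mulr1 x); apply: IM.
Qed.

Lemma ideal_exp_principal_sub g I k : is_ideal I ->
  ideal_exp (ideal_span [set g]) k `<=` I <-> I (g ^+ k).
Proof.
move=> idI; have [_ _ IM] := idI; split=> [|Igk]; first apply.
  elim: k => [|k IHk] //; rewrite exprS; apply: ideal_mulP => //.
  exact: sub_ideal_span.
suff sub : ideal_exp (ideal_span [set g]) k `<=` [set x | exists c, x = c * g ^+ k].
  by move=> x /sub[c ->]; apply: IM.
have id_mult x : is_ideal [set y | exists c, y = c * x].
  split=> [|_ _ [c ->] [d ->]|c _ [d ->]].
  - by exists 0; rewrite mul0r.
  - by exists (c + d); rewrite mulrDl.
  by exists (c * d); rewrite mulrA.
elim: k {Igk} => [|k IHk]; first by move=> x _; exists x; rewrite mulr1.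
apply: ideal_mul_sub => [|x y /(ideal_span_sub (id_mult g)) xP /IHk[d ->]].
  exact: id_mult.
have [_ ->|c ->] := xP; first by exists 1; rewrite mul1r.
by exists (c * d); rewrite exprS mulrACA.
Qed.

End IdealTheory.

Lemma ideal_extension_span (S T : comNzRingType) (f : {rmorphism S -> T}) (A : set S) :
  ideal_extension f (ideal_span A) = ideal_span (f @` A).
Proof.
apply/seteqP; split; apply: ideal_span_sub; try exact: is_ideal_span.
  move=> _ [_ [r [c [u [Au ->]]]] <-]; rewrite rmorph_sum /=.
  apply: is_ideal_sum => [|i _]; first exact: is_ideal_span.
  rewrite rmorphM; have [_ _ IM] := is_ideal_span (f @` A).
  by apply/IM/sub_ideal_span; exists (u i).
move=> _ [x Ax <-]; apply: sub_ideal_span; exists x => //.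
exact: sub_ideal_span.
Qed.

(** * Monomial ideals and their Frobenius powers *)

Definition monomial_exponents n (M : set 'X_{1..n}) : set 'X_{1..n} :=
  [set w | exists2 u, M u & (u <= w)%MM].

Lemma monomial_exponents_upward n (M : set 'X_{1..n}) :
  upward_closed (monomial_exponents M).
Proof.
by move=> u v [w Mw le_wu]; exists w => //; apply: lepm_trans le_wu (lem_addr _ _).
Qed.

Section MonomialIdeals.
Variables (L : fieldType) (p n : nat) (M : set 'X_{1..n}).
Hypothesis charL : p \in [pchar L].
Let B := monomial_exponents M.
Let Bup : upward_closed B := @monomial_exponents_upward n M.

Lemma is_ideal_in_frobenius q : is_ideal (in_frobenius B q : set {mpoly L[n]}).
Proof.
split; [exact: in_frobenius0|move=> x y; exact: in_frobeniusD|].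
by move=> c x; exact: in_frobeniusM.
Qed.

(** For the reverse inclusion, a monomial whose exponent has quotient above some [u] in [M] is a
    multiple of ['X_[u] ^+ (p ^ e)]. *)
Lemma frobenius_power_monomial e :
  frobenius_power (ideal_span [set 'X_[L, u] | u in M]) (p ^ e) =
  in_frobenius B (p ^ e).
Proof.
apply/seteqP; split=> [|h bh].
  apply: ideal_span_sub => [|_ [f bf <-]]; first exact: is_ideal_in_frobenius.
  have : in_frobenius B (p ^ 0) f.
    apply: ideal_span_sub bf => [|_ [u Mu <-] w]; first exact: is_ideal_in_frobenius.
    rewrite mdivn1 mcoeffX; case: eqP => // <- [].
    by exists u => //; apply: lepm_refl.
  by move=> bf0; have := (in_frobenius_exp B charL f e 0).2 bf0; rewrite add0n.
rewrite [h]mpolyE big_seq; apply: is_ideal_sum => [|w]; first exact: is_ideal_span.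
rewrite mcoeff_msupp => hw; have [_ _ IM] := is_ideal_span
  [set f ^+ (p ^ e) | f in ideal_span [set 'X_[L, u] | u in M]].
have [u Mu /mnm_lepP le_u] : B (mdivn w (p ^ e)).
  by apply: contrapT => /bh; apply/eqP.
have -> : w = ((w - u *+ p ^ e) + u *+ p ^ e)%MM.
  rewrite submK //; apply/mnm_lepP => i; rewrite mulmnE.
  by apply: leq_trans (leq_trunc_div (w i) (p ^ e)); rewrite leq_mul2r -mdivnE le_u orbT.
rewrite mpolyXD scalerAl -mpolyXn; apply/IM/sub_ideal_span.
by exists 'X_[u] => //; apply: sub_ideal_span; exists u.
Qed.

End MonomialIdeals.

(** * The generic linear combination of the generators *)

Lemma digit_sum p t k : (0 < p)%N ->
  (\sum_(0 <= i < t) ((k %/ p ^ i) %% p) * p ^ i = k %% p ^ t)%N.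
Proof.
move=> p_gt0; elim: t => [|t IHt]; first by rewrite big_geq // modn1.
rewrite big_nat_recr //= IHt.
have pt_gt0 : (0 < p ^ t)%N by rewrite expn_gt0 p_gt0.
have lt_digit : ((k %/ p ^ t) %% p * p ^ t + k %% p ^ t < p * p ^ t)%N.
  apply: (@leq_trans ((k %/ p ^ t) %% p * p ^ t + p ^ t)%N).
    by rewrite ltn_add2l ltn_mod.
  by rewrite -mulSnr leq_mul2r ltn_mod p_gt0 orbT.
rewrite addnC -(modn_small lt_digit) -(modnMDl (k %/ p ^ t %/ p)) -expnS.
by rewrite addnA [(p ^ t.+1)%N in X in (X + _ + _)%N]expnS mulnA -mulnDl -!divn_eq.
Qed.

Section GenericCombination.
Variables (S : comNzRingType) (p m : nat).
Hypothesis charS : p \in [pchar S].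
Variable g : 'I_m -> S.

Let p_prime : prime p. Proof. exact: pcharf_prime charS. Qed.
Let p_gt0 : (0 < p)%N. Proof. exact: prime_gt0. Qed.

Definition generic_combination : {mpoly S[m]} := \sum_i g i *: 'X_i.

Let G := generic_combination.
Let a := ideal_span (range g).

Lemma mcoeff_generic_mul (F : {mpoly S[m]}) U :
  (G * F)@_U = \sum_i g i * (if (U_(i) <= U)%MM then F@_(U - U_(i))%MM else 0).
Proof.
rewrite mulr_suml raddf_sum /=; apply: eq_bigr => i _.
by rewrite -scalerAl mcoeffZ mcoeffXM.
Qed.

Lemma mcoeff_generic_deg U : (1 < mdeg U)%N -> G@_U = 0.
Proof.
move=> lt_U; rewrite raddf_sum /= big1 // => i _; rewrite mcoeffZ mcoeffX.
by case: eqP lt_U => [<-|]; rewrite ?mdeg1 ?mulr0.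
Qed.

Lemma mcoeff_generic_exp_deg k U : (k < mdeg U)%N -> (G ^+ k)@_U = 0.
Proof.
by move=> lt_U; apply: (mcoeff_expr_deg mcoeff_generic_deg); rewrite mul1n.
Qed.

Lemma mcoeff_generic_exp_mem k U : ideal_exp a k ((G ^+ k)@_U).
Proof.
elim: k U => [|k IHk] U //; rewrite exprS mcoeff_generic_mul.
apply: is_ideal_sum => [|i _]; first exact: is_ideal_exp.
case: ifP => _; last by rewrite mulr0; case: (is_ideal_exp a k.+1).
by apply: ideal_mulP; [apply: sub_ideal_span; exists i|apply: IHk].
Qed.

Let mfact (U : 'X_{1..m}) := (\prod_i (U i)`!)%N.

Let mfactU1 i U : mfact (U_(i) + U)%MM = ((U i).+1 * mfact U)%N.
Proof.
rewrite /mfact (bigD1 i) //= [in RHS](bigD1 i) //= mnmDE mnm1E eqxx factS mulnA.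
congr (_ * _)%N; apply: eq_bigr => j neq_ji.
by rewrite mnmDE mnm1E eq_sym (negPf neq_ji).
Qed.

(* The multinomial theorem; [(mfact U)%:R] may vanish for [k >= p]. *)
Lemma mcoeff_generic_exp k U : mdeg U = k ->
  (mfact U)%:R * (G ^+ k)@_U = k`!%:R * mmap1 g U.
Proof.
elim: k U => [|k IHk] U degU.
  move/eqP: degU; rewrite mdeg_eq0 => /eqP ->.
  by rewrite expr0 mcoeff1 eqxx mmap11 /mfact big1 // => i _; rewrite mnm0E.
rewrite exprS mcoeff_generic_mul mulr_sumr.
transitivity (\sum_i (U i)%:R * (k`!%:R * mmap1 g U)).
  apply: eq_bigr => i _; rewrite lep1mP.
  have [->|Ui] := eqVneq (U i) 0%N; first by rewrite /= !mulr0 mul0r.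
  have UE : U = (U_(i) + (U - U_(i)))%MM by rewrite addmC submK // lep1mP.
  have -> : mfact U = (U i * mfact (U - U_(i))%MM)%N.
    by rewrite {1}UE mfactU1 mnmBE mnm1E eqxx subn1 prednK ?lt0n.
  have -> : mmap1 g U = g i * mmap1 g (U - U_(i))%MM.
    rewrite {1}UE commr_mmap1_M ?mmap1U // => j x.
    exact: mulrC.
  rewrite [k`!%:R * _]mulrCA -IHk /= ?natrM; first by ring.
  by move: degU; rewrite {1}UE mdegD mdeg1 add1n => -[].
by rewrite -mulr_suml -natr_sum -mdegE degU mulrA -natrM factS.
Qed.

Lemma ideal_exp_sub_monomials (I : set S) k : is_ideal I ->
  (forall U, mdeg U = k -> I (mmap1 g U)) -> ideal_exp a k `<=` I.
Proof.
elim: k I => [|k IHk] I idI Ig.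
  by rewrite (is_ideal1 idI) // -(mmap11 g); apply: Ig; rewrite mdeg0.
apply: ideal_mul_sub => // x y ax ay; rewrite mulrC.
apply: (ideal_span_sub (is_ideal_colon y idI)) ax => _ [i _ <-] /=.
rewrite mulrC; apply: (IHk [set z | I (g i * z)]) ay => [|U degU /=].
  exact: is_ideal_colon.
rewrite -(mmap1U g i) -commr_mmap1_M; last by move=> j x'; apply: mulrC.
by apply: Ig; rewrite mdegD mdeg1 degU.
Qed.

Lemma natr_invertible_pchar k : coprime p k -> exists c : S, c * k%:R = 1.
Proof.
move=> co_pk; have [c _] := Bezoutl k p_gt0.
rewrite (eqP co_pk) (dvdn_pcharf charS) natrD natrM => /eqP ck.
by exists (- c%:R); apply/eqP; rewrite mulNr -subr_eq0 -opprD oppr_eq0 addrC ck.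
Qed.

(** For [k < p] the factorial of [k] is invertible, so the multinomial theorem makes each monomial
    of degree [k] in the [g i] a multiple of a coefficient of [G ^+ k]. *)
Lemma ideal_exp_sub_mcoeff (I : set S) k : is_ideal I -> (k < p)%N ->
  (forall U, I ((G ^+ k)@_U)) -> ideal_exp a k `<=` I.
Proof.
move=> idI lt_kp IG; apply: ideal_exp_sub_monomials => // U degU.
have [c ck] : exists c : S, c * k`!%:R = 1.
  apply: natr_invertible_pchar; rewrite prime_coprime //.
  elim: k lt_kp {IG degU} => [|j IHj] lt_jp.
    by rewrite dvdn1 gtn_eqF ?prime_gt1.
  rewrite factS Euclid_dvdM // negb_or IHj ?(ltnW lt_jp) // andbT.
  by apply: contraL lt_jp => p_dvd; rewrite -leqNgt dvdn_leq.
have [_ _ IM] := idI; rewrite -(mul1r (mmap1 g U)) -ck -mulrA.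
by rewrite -mcoeff_generic_exp // !mulrA; apply/IM/IG.
Qed.

Variable k : nat.
Let dig i := ((k %/ p ^ i) %% p)%N.
(** [H] and [K] restrict the digit power and the digit expansion to the places from [s] to [t - 1],
    so that an induction can split off the lowest digit. *)
Let H s t := \big[@ideal_mul S/setT]_(s <= i < t)
  frobenius_power (ideal_exp a (dig i)) (p ^ i).
Let K s t := (\sum_(s <= i < t) dig i * p ^ i)%N.

Let K_recl s r : K s (s + r.+1) = (dig s * p ^ s + K s.+1 (s.+1 + r))%N.
Proof. by rewrite addnS -addSn /K big_ltn // addSn ltnS leq_addr. Qed.

Let H_recl s r : H s (s + r.+1) =
  ideal_mul (frobenius_power (ideal_exp a (dig s)) (p ^ s)) (H s.+1 (s.+1 + r)).
Proof. by rewrite addnS -addSn /H big_ltn // addSn ltnS leq_addr. Qed.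

Let K_dvd s r : (p ^ s %| K s (s + r))%N.
Proof.
elim: r s => [|r IHr] s; first by rewrite addn0 /K big_geq.
rewrite K_recl dvdn_add ?dvdn_mull //; apply: dvdn_trans (IHr s.+1).
by rewrite expnS dvdn_mull.
Qed.

Let H_mcoeff s r U : H s (s + r) ((G ^+ K s (s + r))@_U).
Proof.
elim: r s U => [|r IHr] s U; first by rewrite addn0 /H big_geq.
rewrite H_recl K_recl exprD exprM mcoeffM.
apply: is_ideal_sum => [|[U1 U2] _ /=]; first exact: is_ideal_mul.
apply: ideal_mulP => //; have idF := is_ideal_span
  [set f ^+ (p ^ s) | f in ideal_exp a (dig s)].
have [[V ->]|nV] := pselect (exists V, bmnm U1 = V *+ p ^ s)%MM; last first.
  by rewrite (mcoeff_exp charS) //; case: idF.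
rewrite (mcoeff_expMn charS); apply: sub_ideal_span.
by exists ((G ^+ dig s)@_V) => //; apply: mcoeff_generic_exp_mem.
Qed.

Let H_sub s r (I : set S) : is_ideal I ->
  (forall U, I ((G ^+ K s (s + r))@_U)) -> H s (s + r) `<=` I.
Proof.
elim: r s I => [|r IHr] s I idI IG.
  rewrite (is_ideal1 idI) //; have := IG 0%MM.
  by rewrite addn0 /K big_geq // expr0 mcoeff1 eqxx.
have [I0 ID IM] := idI.
have dig_lt : (dig s < p)%N by rewrite ltn_mod.
have [c Kc] := dvdnP (K_dvd s.+1 r).
(* Each such product is zero or a single coefficient of [G ^+ K s (s + r.+1)]: as [dig s < p], the
   factor at the lowest digit has degree below [p] in the parameters, and no two terms collide. *)
have IGG V U : I ((G ^+ dig s)@_V ^+ (p ^ s) * (G ^+ K s.+1 (s.+1 + r))@_U).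
  have [le_pV|lt_Vp] := leqP p (mdeg V).
    rewrite mcoeff_generic_exp_deg ?(leq_trans dig_lt) // expr0n.
    by rewrite gtn_eqF ?expn_gt0 ?p_gt0 // mul0r.
  have [[W ->]|nW] := pselect (exists W, U = W *+ p ^ s.+1)%MM; last first.
    by rewrite Kc exprM (mcoeff_exp charS) // mulr0.
  have -> : (G ^+ dig s)@_V ^+ (p ^ s) *
      (G ^+ K s.+1 (s.+1 + r))@_(W *+ p ^ s.+1)%MM =
      (G ^+ K s (s + r.+1))@_((V + W *+ p ^ 1) *+ p ^ s)%MM.
    rewrite K_recl Kc [in LHS]exprM (mcoeff_expMn charS).
    rewrite (_ : (dig s * p ^ s + c * p ^ s.+1 = (c * p ^ 1 + dig s) * p ^ s)%N).
      rewrite [in RHS]exprM (mcoeff_expMn charS) exprD exprM.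
      rewrite (mcoeff_exp_mul_small charS) ?expn1 // => [|w le_pw].
        by rewrite exprMn -exprM -expnS mulrC.
      by apply: mcoeff_generic_exp_deg; apply: leq_trans le_pw.
    by rewrite expn1 mulnDl -mulnA -expnS addnC.
  exact: IG.
rewrite H_recl; apply: ideal_mul_sub => // x y Fx Hy; rewrite mulrC.
apply: (ideal_span_sub (is_ideal_colon y idI)) Fx => _ [f af <-] /=.
(* The set of [f] with [y * f ^+ (p ^ s)] in [I] is an ideal because Frobenius is additive. *)
apply: (ideal_exp_sub_mcoeff (I := [set f | I (y * f ^+ (p ^ s))])) af => // [|V /=].
  split=> [|f1 f2 /= If1 If2|f1 f2 /= If2].
  - by rewrite /= expr0n gtn_eqF ?expn_gt0 ?p_gt0 // mulr0.
  - have := sum_exp_pchar [:: f1; f2] id s charS.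
    by rewrite !big_cons !big_nil !addr0 => ->; rewrite mulrDr; apply: ID.
  by rewrite exprMn mulrCA; apply: IM.
rewrite mulrC; apply: (IHr s.+1 [set z | I ((G ^+ dig s)@_V ^+ (p ^ s) * z)]) Hy.
  exact: is_ideal_colon.
by move=> U; apply: IGG.
Qed.

Lemma digit_power_subP (I : set S) : is_ideal I ->
  digit_power p a k `<=` I <-> forall U, I ((G ^+ k)@_U).
Proof.
(* Since [k < p ^ k.+1], the first [k.+1] digits recover [k]. *)
have KE : K 0 (0 + k.+1) = k.
  rewrite /K digit_sum // modn_small // (leq_trans (ltn_expl k (prime_gt1 p_prime))) //.
  by rewrite leq_exp2l ?prime_gt1.
have HE : digit_power p a k = H 0 (0 + k.+1) by rewrite /H big_mkord.
move=> idI; rewrite HE; split=> [HI U|IG].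
  by apply: HI; have := H_mcoeff 0 k.+1 U; rewrite KE.
by apply: H_sub => // U; rewrite KE.
Qed.

End GenericCombination.

Section GenericFamily.
Variables (K : fieldType) (p n m : nat) (B : set 'X_{1..n}).
Hypothesis charK : p \in [pchar K].
Hypothesis Bup : upward_closed B.
Hypothesis B0 : ~ B 0%MM.
Variable g : 'I_m -> {mpoly K[n]}.
Hypothesis g_radical : forall i, exists l, in_frobenius B 1 (g i ^+ l).

Let p_prime : prime p. Proof. exact: pcharf_prime charK. Qed.
Let p_gt0 : (0 < p)%N. Proof. exact: prime_gt0. Qed.
Let charS : p \in [pchar {mpoly K[n]}]. Proof. exact: pchar_mpoly. Qed.

Local Notation G := (generic_combination g).

Definition generic_family k e :=
  forall U, in_frobenius B (p ^ e) ((G ^+ k)@_U).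

Lemma generic_level_family : level_family p generic_family.
Proof.
split=> [e|k e bG U|k e|].
- by move=> /(_ 0%MM); rewrite expr0 mcoeff1 eqxx; apply: in_frobenius1.
- rewrite exprS mcoeff_generic_mul; apply: in_frobenius_sum => i _.
  apply: in_frobeniusM => //; case: ifP => _; first exact: bG.
  exact: in_frobenius0.
- have expE (F : {mpoly K[n]}) :
      in_frobenius B (p ^ e.+1) (F ^+ p) <-> in_frobenius B (p ^ e) F.
    by have := in_frobenius_exp B charK F 1 e; rewrite addn1 expn1.
  rewrite /generic_family exprM -[X in (G ^+ k) ^+ X]expn1.
  split=> bG U.
    by apply/expE; have := bG (U *+ p ^ 1)%MM; rewrite mcoeff_expMn // expn1.
  have [[V ->]|nV] := pselect (exists V, U = V *+ p ^ 1)%MM.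
    by rewrite mcoeff_expMn // expn1; apply/expE.
  by rewrite mcoeff_exp //; apply: in_frobenius0.
have /choice[l lP] := g_radical.
(* A power of [p] distributes over the sum [G], and this one exceeds every [l i]. *)
exists (p ^ \max_i l i)%N => U; rewrite expn0 sum_exp_pchar ?pchar_mpoly //.
rewrite raddf_sum /=; apply: in_frobenius_sum => i _.
rewrite exprZn mcoeffZ mulrC; apply: in_frobeniusM => //.
have /subnK <- : (l i <= p ^ \max_i l i)%N.
  apply: leq_trans (ltnW (ltn_expl _ (prime_gt1 p_prime))).
  exact: leq_bigmax.
by rewrite exprD; apply: in_frobeniusM.
Qed.

(** One more factor [G] after raising to the power [p ^ t] produces the coefficient
    [(G ^+ N e)@_U ^+ (p ^ t) * g i], which can be kept outside the Frobenius power. *)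
Lemma generic_level_strict : (forall i, g i <> 0) -> (0 < m)%N ->
  forall e, exists t,
    (p ^ t * level generic_family e < level generic_family (e + t))%N.
Proof.
move=> g_neq0 m_gt0 e; set N := level generic_family.
have NP k e' : generic_family k e' <-> (N e' < k)%N.
  exact: levelP generic_level_family k e'.
have [U nU] : exists U, ~ in_frobenius B (p ^ e) ((G ^+ N e)@_U).
  apply: contrapT => nex; have /NP : ~ (N e < N e)%N by rewrite ltnn.
  by apply=> U; apply: contrapT => nU; apply: nex; exists U.
pose i := Ordinal m_gt0.
have gi_neq0 : g i != 0 by apply/eqP/g_neq0.
have [t t_gt0 nt] := in_frobenius_exp_mul charK gi_neq0 nU.
have pt_gt1 : (1 < p ^ t)%N.
  by rewrite (leq_trans (prime_gt1 p_prime)) // -{1}(expn1 p) leq_exp2l ?prime_gt1.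
exists t; rewrite ltnNge; apply/negP => le_N; apply: nt.
have /NP/(_ (U_(i) + U *+ p ^ t)%MM) : (N (e + t) < N e * p ^ t + 1)%N.
  by rewrite addn1 ltnS mulnC.
rewrite exprD exprM expr1 (mcoeff_exp_mul_small charS) ?mdeg1 //.
  rewrite [G@__]raddf_sum /= (bigD1 i) //= mcoeffZ mcoeffXU eqxx mulr1 big1 ?addr0 //.
  by move=> j neq_ji; rewrite mcoeffZ mcoeffXU (negPf neq_ji) mulr0.
by move=> w le_w; apply: mcoeff_generic_deg; apply: leq_trans le_w.
Qed.

(** * Specialization of the parameters *)

Variables (L : fieldType) (iota : {rmorphism K -> L}) (gamma : 'I_m -> L).

Definition specialization : {mpoly {mpoly K[n]}[m]} -> {mpoly L[n]} :=
  mmap (map_mpoly iota) (fun i => (gamma i)%:MP).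

Lemma specialization_generic k :
  (\sum_i gamma i *: map_mpoly iota (g i)) ^+ k = specialization (G ^+ k).
Proof.
rewrite /specialization rmorphXn raddf_sum /=; congr (_ ^+ _); apply: eq_bigr => i _.
by rewrite mmapZ mmapX mmap1U mulrC mul_mpolyC.
Qed.

Lemma specializationE F : specialization F =
  \sum_(U <- msupp F) mmap1 gamma U *: map_mpoly iota F@_U.
Proof.
rewrite /specialization /mmap; apply: eq_bigr => U _.
rewrite mulrC -mul_mpolyC; congr (_ * _).
by rewrite /mmap1 rmorph_prod; apply: eq_bigr => i _; rewrite rmorphXn.
Qed.

Lemma in_frobenius_specialization q F :
  (forall U, in_frobenius B q F@_U) -> in_frobenius B q (specialization F).
Proof.
move=> bF; rewrite specializationE; apply: in_frobenius_sum => U _ w Bw.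
by rewrite mcoeffZ mcoeff_map_mpoly bF // raddf0 mulr0.
Qed.

(** The roles of the two sets of variables are exchanged: this is the coefficient of ['X_[w]], as a
    polynomial in the parameters. *)
Definition coefficient_in_parameters (F : {mpoly {mpoly K[n]}[m]})
    (w : 'X_{1..n}) : {mpoly K[m]} :=
  \sum_(U <- msupp F) (F@_U)@_w *: 'X_[U].

Lemma meval_coefficient_in_parameters F w :
  (map_mpoly iota (coefficient_in_parameters F w)).@[gamma] =
  (specialization F)@_w.
Proof.
rewrite specializationE /coefficient_in_parameters (raddf_sum (map_mpoly iota)).
rewrite (raddf_sum (meval gamma)) (raddf_sum (mcoeff w)) /=.
apply: eq_bigr => U _.
by rewrite map_mpolyZ map_mpolyX mevalZ mevalX mcoeffZ mcoeff_map_mpoly mulrC.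
Qed.

End GenericFamily.

Theorem theorem5p14 (R : realType) (p : nat) (K : fieldType)
    (charK : p \in [pchar K]) (FK : F_finite p K)
    (n m : nat) (g : 'I_m -> {mpoly K[n]})
    (g_neq0 : forall i, g i <> 0)
    (a : set {mpoly K[n]}) (a_def : a = ideal_span (range g))
    (a_proper : a <> setT)
    (b : set {mpoly K[n]}) (b_monomial : monomial_ideal b)
    (b_proper : b <> setT) (ab : a `<=` ideal_radical b) :
  exists E : set {mpoly K[m]},
    forall (L : fieldType) (iota : {rmorphism K -> L}), F_finite p L ->
    forall gamma : 'I_m -> L,
      let gL : {mpoly L[n]} := \sum_(i < m) gamma i *: map_mpoly iota (g i) in
      let bL : set {mpoly L[n]} := ideal_extension (map_mpoly iota) b in
      gL <> 0 ->
      (F_threshold R p bL (ideal_span [set gL]) = critical_exponent R p b a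
       <-> ~ zero_locus iota E gamma).
Proof.
have p_prime := pcharf_prime charK.
have p_gt0 : (0 < p)%N by exact: prime_gt0.
have p_gt1 : (1 < p)%N by exact: prime_gt1.
have [M bE] := b_monomial; pose B := monomial_exponents M.
have Bup : upward_closed B by exact: monomial_exponents_upward.
have bP e : frobenius_power b (p ^ e) = in_frobenius B (p ^ e).
  by rewrite bE frobenius_power_monomial.
have b1 : b `<=` in_frobenius B 1.
  move=> f bf; have := bP 0%N; rewrite expn0 => <-.
  by apply: sub_ideal_span; exists f.
have B0 : ~ B 0%MM.
  move=> [u Mu le_u0]; apply: b_proper; rewrite bE; apply: is_ideal1.
    exact: is_ideal_span.
  rewrite -mpolyX0; apply: sub_ideal_span; exists u => //.
  congr mpolyX; apply/mnmP => i; have /mnm_lepP/(_ i) := le_u0.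
  by rewrite mnm0E leqn0 => /eqP.
have g_radical i : exists l, in_frobenius B 1 (g i ^+ l).
  have [|l bl] := ab (g i); last by exists l; apply: b1.
  by rewrite a_def; apply: sub_ideal_span; exists i.
(* Without generators [gL] is zero, so any [E] will do. *)
case: (posnP m) => [m0|m_gt0].
  exists set0 => L iota _ gamma gL bL; case; rewrite /gL big1 // => -[i lt_im].
  by exfalso; rewrite m0 in lt_im.
pose P := generic_family p B g; pose N := level P.
have famP : level_family p P by exact: generic_level_family.
have NP k e : P k e <-> (N e < k)%N by exact: levelP famP k e.
have tN : p_truncations p N by exact: level_truncations.
have critE : critical_exponent R p b a =
    limn (fun e => (N e)%:R / (p ^ e)%:R : R).
  congr (limn _); apply/funext => e; congr (_%:R / _); rewrite /mu /N /level.
  congr max_nat; apply/seteqP.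
  by split=> k /= nk bk; apply: nk; move: bk; rewrite bP a_def
    (digit_power_subP (pchar_mpoly _ charK) _ _ (is_ideal_in_frobenius _ _ _)).
(* [msize] is the degree plus one for nonzero polynomials, so [d] bounds the degree of [gL] for all
   [L] and [gamma]. *)
pose d := \max_i msize (g i); pose D := #|{: 'X_{1..n < d.+1}}|.
pose e0 := (D + D`!)%N.
(* The condition on the digits of [N] does not involve [w]: if it fails, [E] is empty and its zero
   locus is the whole space. *)
pose E := [set coefficient_in_parameters (generic_combination g ^+ N e0) w
            | w in [set w | ~ B (mdivn w (p ^ e0)) /\ digits_recur p D N]].
exists E => L iota _ gamma gL bL gL_neq0.
have charL : p \in [pchar L] by rewrite (fmorph_pchar iota).
have bLP e : frobenius_power bL (p ^ e) = in_frobenius B (p ^ e).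
  rewrite -frobenius_power_monomial // /bL bE ideal_extension_span image_comp.
  by congr (frobenius_power (ideal_span _) _); apply: eq_imagel => u _ /=; rewrite map_mpolyX.
have gLk k : gL ^+ k = specialization iota gamma (generic_combination g ^+ k).
  exact: specialization_generic.
pose PL := powers_family p B gL; pose NL := level PL.
have PPL k e : P k e -> PL k e.
  by move=> Pk; rewrite /PL /powers_family gLk; apply: in_frobenius_specialization.
have gL_radical : exists l, in_frobenius B 1 (gL ^+ l).
  by have [_ _ _ [l Pl]] := famP; exists l; exact: (PPL l 0%N Pl).
have gL_deg w : (d < mdeg w)%N -> gL@_w = 0.
  move=> lt_dw; rewrite raddf_sum /= big1 // => i _.
  rewrite mcoeffZ mcoeff_map_mpoly memN_msupp_eq0 ?raddf0 ?mulr0 //.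
  apply: msize_mdeg_ge; apply: leq_trans (ltnW lt_dw).
  exact: (leq_bigmax (F := fun i => msize (g i))).
have famPL : level_family p PL by exact: powers_level_family.
have NLP k e : PL k e <-> (NL e < k)%N by exact: levelP famPL k e.
have tNL : p_truncations p NL by exact: level_truncations.
have recNL : digits_recur p D NL by exact: powers_level_digits_recur.
have threshE : F_threshold R p bL (ideal_span [set gL]) =
    limn (fun e => (NL e)%:R / (p ^ e)%:R : R).
  congr (limn _); apply/funext => e; congr (_%:R / _); rewrite /nu /NL /level.
  congr max_nat; apply/seteqP.
  by split=> k /= nk bk; apply: nk; move: bk; rewrite bLP
    (ideal_exp_principal_sub _ _ (is_ideal_in_frobenius _ _ _)).
have leN e : (NL e <= N e)%N.
  by rewrite -ltnS; apply/NLP/PPL/NP.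
rewrite threshE critE (p_truncations_lim_eq p_gt1 R tNL tN leN); last first.
  exact: generic_level_strict.
(* If all equations vanished at [gamma], then [gL ^+ N e0] would lie in the Frobenius power, against
   [NL e0 = N e0]. Recurrence passes from [NL] to [N]. *)
split=> [eqN zE|nz].
  have : ~ (NL e0 < N e0)%N by rewrite eqN ltnn.
  move=> /NLP; apply=> w Bw; rewrite gLk -meval_coefficient_in_parameters.
  apply: zE; exists w => //; split=> //.
  by move: recNL; rewrite (_ : NL = N) //; apply/funext.
(* An equation that does not vanish yields both the recurrence of [N] and a coefficient forcing
   [NL e0 = N e0]; agreement at [e0] then suffices. *)
have [w [[Bw recN] cw]] : exists w, (~ B (mdivn w (p ^ e0)) /\ digits_recur p D N)
    /\ (gL ^+ N e0)@_w != 0.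
  apply: contrapT => nex; apply: nz => _ [w Bw <-].
  rewrite meval_coefficient_in_parameters -gLk; apply/eqP/negPn/negP => cw.
  by apply: nex; exists w.
apply: (p_truncations_eq p_gt1 tNL tN recNL recN).
apply/eqP; rewrite eqn_leq leN /= leqNgt; apply/negP => /NLP/(_ w Bw).
by apply/eqP.
Qed.
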